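(* For the complete bipartite graph $K_{r,s}$ (with parts of sizes $r$ and $s$, where $r,s\ge 1$): $SC(K_{r,s})=2$ if $r>s>1$, and $SC(K_{r,s})=2r$ if $r=s$.
   Context: Graphs are finite, simple and undirected, with nonempty vertex set $V(G)$; the order is $n=|V(G)|$. A set $D\subseteq V(G)$ is a strong dominating set of $G$ if for every $x\in V(G)\setminus D$ there is $y\in D$ with $xy\in E(G)$ and $\deg(x)\le\deg(y)$. Two disjoint sets $V_1,V_2\subseteq V(G)$ form a strong coalition if neither is a strong dominating set but $V_1\cup V_2$ is a strong dominating set. A strong coalition partition of $G$ is a partition $\Omega=\{V_1,\dots,V_k\}$ of $V(G)$ into nonempty sets such that each $V_i$ either is a strong dominating set consisting of a single vertex of degree $n-1$, or is not a strong dominating set but forms a strong coalition with another set $V_j\in\Omega$ that is not a strong dominating set. The strong coalition number $SC(G)$ is the maximum cardinality of a strong coalition partition of $G$, with $SC(G)=0$ if $G$ has no strong coalition partition. *)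

(* Defs.v *)
From mathcomp Require Import all_boot.

Set Implicit Arguments.
Unset Strict Implicit.
Unset Printing Implicit Defensive.

(* The vertex type may be empty here; statements exclude that case when needed. *)

Record sgraph := SGraph {
  vertex :> finType;
  edge : rel vertex;
  edge_sym : symmetric edge;
  edge_irrefl : irreflexive edge
}.

Section StrongCoalition.

Variable G : sgraph.

Definition deg (x : G) : nat := #|[set y | edge x y]|.

Definition strong_dominating (D : {set G}) : bool :=
  [forall x in ~: D, exists y in D, edge x y && (deg x <= deg y)].

Definition strong_coalition (A B : {set G}) : bool :=
  [&& [disjoint A & B], ~~ strong_dominating A, ~~ strong_dominating B
    & strong_dominating (A :|: B)].

Definition dominating_singleton (A : {set G}) : bool :=
  strong_dominating A && [exists x, (A == [set x]) && (deg x == #|G| - 1)].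

(* [partition] requires the blocks to be nonempty. *)
Definition strong_coalition_partition (P : {set {set G}}) : bool :=
  partition P [set: G] &&
  [forall A in P,
     dominating_singleton A ||
     ~~ strong_dominating A &&
     [exists B in P, (B != A) && strong_coalition A B]].

(* [\max] over an empty range is 0, the value of SC on graphs without any
   strong coalition partition. *)
Definition SC : nat := \max_(P | strong_coalition_partition P) #|P|.

End StrongCoalition.

Section CompleteBipartite.

Variables r s : nat.

Definition is_left (x : 'I_r + 'I_s) : bool := if x is inl _ then true else false.

Definition Krs_edge : rel ('I_r + 'I_s) := fun x y => is_left x != is_left y.

Lemma Krs_edge_sym : symmetric Krs_edge.
Proof. by move=> x y; rewrite /Krs_edge eq_sym. Qed.

Lemma Krs_edge_irrefl : irreflexive Krs_edge.
Proof. by move=> x; rewrite /Krs_edge eqxx. Qed.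

Definition complete_bipartite : sgraph := SGraph Krs_edge_sym Krs_edge_irrefl.

End CompleteBipartite.

(* Main.v *)
Require Import Defs.
From mathcomp Require Import all_boot.

Set Implicit Arguments.
Unset Strict Implicit.
Unset Printing Implicit Defensive.

(** Suppose first that [1 < s < r].  A vertex of the smaller part has degree
    [r], larger than the degree [s] of all its neighbours, so it can only be
    strongly dominated by itself; hence the strong dominating sets are exactly
    the supersets of the smaller part ([strong_dominating_unbalanced]).  Let
    [A] and [B] be coalition partners.  They cover the smaller part, so any
    third block [C] misses it; a partner of [C] would then have to contain the
    whole smaller part, and would be strong dominating by itself.  So there are
    at most two blocks, and two are attained by one vertex of the smaller part
    against all other vertices.

    If [r = s] the graph is regular, so strong domination is domination.  Two
    vertices in different parts always dominate, and a single vertex dominates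
    only if [r = 1], in which case its degree is [1 = n - 1].  So the partition
    into singletons is a strong coalition partition, and no partition has more
    blocks than there are vertices. *)

Section Graph.

Variable G : sgraph.
Implicit Types (A B C D : {set G}) (P : {set {set G}}).

Lemma strong_dominatingP D :
  reflect (forall x, x \notin D ->
             exists2 y, y \in D & edge x y && (deg x <= deg y))
          (strong_dominating D).
Proof.
apply: (iffP forall_inP) => [H x xD | H x].
  by apply/exists_inP/H; rewrite in_setC.
by rewrite in_setC => /H H1; apply/exists_inP.
Qed.

Lemma strong_dominatingT : strong_dominating [set: G].
Proof. by apply/strong_dominatingP => x; rewrite in_setT. Qed.

Lemma SC_eq k :
    (forall P, strong_coalition_partition P -> #|P| <= k) ->
    (exists2 P : {set {set G}}, strong_coalition_partition P & #|P| = k) ->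
  SC G = k.
Proof.
move=> ub [P scpP cardP]; apply/eqP; rewrite eqn_leq; apply/andP; split.
  exact/bigmax_leqP.
by rewrite -cardP; apply: leq_bigmax_cond.
Qed.

Lemma leq_card_strong_coalition_partition P :
  strong_coalition_partition P -> #|P| <= #|G|.
Proof.
case/andP=> partP _; rewrite -cardsT (card_partition partP) -sum1_card.
apply: leq_sum => A AP; rewrite card_gt0; apply: contraTneq AP => ->.
by case/and3P: partP.
Qed.

(** As the whole vertex set is strong dominating, two complementary sets form
    a strong coalition as soon as neither is strong dominating. *)
Lemma strong_coalition_partition_setC A :
    A != set0 -> ~: A != set0 ->
    ~~ strong_dominating A -> ~~ strong_dominating (~: A) ->
  strong_coalition_partition [set A; ~: A] /\ #|[set A; ~: A]| = 2.
Proof.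
move=> A0 cA0 sdA sdcA.
have disjA : [disjoint A & ~: A] by rewrite disjoints_subset setCK.
have neqA : A != ~: A.
  by apply: contraNneq A0 => eqA; rewrite -(setIid A) {2}eqA setICr.
split; last by rewrite cards2 neqA.
apply/andP; split.
  apply/and3P; split.
  - by rewrite /cover big_setU1 ?in_set1 //= big_set1 setUCr.
  - apply/trivIsetP => B C.
    by rewrite !inE => /orP[] /eqP -> /orP[] /eqP ->; rewrite ?eqxx // disjoint_sym.
  - by rewrite !inE !(eq_sym set0) negb_or A0.
apply/forall_inP => B; rewrite !inE => /orP[] /eqP ->; apply/orP; right.
  rewrite sdA; apply/exists_inP; exists (~: A); first by rewrite !inE eqxx orbT.
  by rewrite eq_sym neqA /strong_coalition disjA sdA sdcA setUCr strong_dominatingT.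
rewrite sdcA; apply/exists_inP; exists A; first by rewrite !inE eqxx.
by rewrite neqA /strong_coalition disjoint_sym disjA sdA sdcA setUC setUCr strong_dominatingT.
Qed.

Lemma strong_coalition_partition_set1 :
    (forall x : G, dominating_singleton [set x] \/
       ~~ strong_dominating [set x] /\
       exists2 y, strong_coalition [set x] [set y] & y != x) ->
  strong_coalition_partition [set [set x] | x : G].
Proof.
move=> H; apply/andP; split.
  apply/and3P; split.
  - apply/eqP/setP => x; rewrite in_setT; apply/bigcupP.
    by exists [set x]; rewrite ?set11 ?imset_f.
  - apply/trivIsetP => _ _ /imsetP[x _ ->] /imsetP[y _ ->] neq.
    by rewrite disjoints1 in_set1; apply: contraNneq neq => ->.
  - by apply/imsetP => -[x _ /setP/(_ x)]; rewrite set11 in_set0.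
apply/forall_inP => _ /imsetP[x _ ->].
case: (H x) => [-> // | [sdx [y co neq]]].
apply/orP; right; rewrite sdx; apply/exists_inP; exists [set y].
  exact: imset_f.
by rewrite co andbT; apply: contraNneq neq => /set1_inj ->.
Qed.

End Graph.

Section CompleteBipartite.

Variables r s : nat.
Notation K := (complete_bipartite r s).

Lemma deg_inl (i : 'I_r) : deg (inl i : K) = s.
Proof.
rewrite /deg -[RHS]card_ord -cardsT -(card_imset _ (@inr_inj 'I_r 'I_s)).
apply: eq_card => -[k|k]; rewrite inE.
  by symmetry; apply/imsetP => -[].
by symmetry; apply/imsetP; exists k.
Qed.

Lemma deg_inr (j : 'I_s) : deg (inr j : K) = r.
Proof.
rewrite /deg -[RHS]card_ord -cardsT -(card_imset _ (@inl_inj 'I_r 'I_s)).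
apply: eq_card => -[k|k]; rewrite inE.
  by symmetry; apply/imsetP; exists k.
by symmetry; apply/imsetP => -[].
Qed.

Lemma strong_dominating_unbalanced (D : {set K}) : 0 < s -> s < r ->
  reflect (forall j, inr j \in D) (strong_dominating D).
Proof.
move=> s_gt0 lt_sr; apply: (iffP (strong_dominatingP _)) => [H j | H].
  apply: contraT => /H[[i|k] _ /andP[]] //.
  by rewrite deg_inl deg_inr leqNgt lt_sr.
case=> [i|j] xD; last by rewrite H in xD.
exists (inr (Ordinal s_gt0)); first exact: H.
by rewrite deg_inl deg_inr ltnW.
Qed.

Lemma leq_card_unbalanced (P : {set {set K}}) : 1 < s -> s < r ->
  strong_coalition_partition P -> #|P| <= 2.
Proof.
move=> s_gt1 lt_sr /andP[/and3P[covP trivP _] /forall_inP H].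
have sdP D := strong_dominating_unbalanced D (ltnW s_gt1) lt_sr.
(* No block is a dominating singleton: it would contain the smaller part,
   which has at least two vertices. *)
have part A : A \in P -> ~~ strong_dominating A /\
    exists2 B, B \in P & strong_coalition A B.
  move=> /H /orP[/andP[/sdP sdA /existsP[x /andP[/eqP eqA _]]] | /andP[sdA]].
    have := sdA (Ordinal s_gt1); have := sdA (Ordinal (ltnW s_gt1)).
    by rewrite eqA !in_set1 => /eqP <-.
  by move/exists_inP => [B BP /andP[_ co]]; split=> //; exists B.
case: (set_0Vmem P) => [-> | [A AP]]; first by rewrite cards0.
have [_ [B BP /and4P[_ _ _ /sdP coverAB]]] := part A AP.
suff /subset_leq_card le2 : P \subset [set A; B].
  by apply: leq_trans le2 _; rewrite cards2; case: (_ == _).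
apply/subsetP => C CP; rewrite !inE; apply: contraT.
rewrite negb_or => /andP[neqA neqB].
have missC j : inr j \notin C.
  have disj E : E \in P -> C != E -> inr j \in E -> inr j \notin C.
    move=> EP neq jE; apply/negP => jC.
    by have /disjointFr/(_ jC) := trivIsetP trivP C E CP EP neq; rewrite jE.
  by have /setUP[] := coverAB j; apply: disj.
have [_ [D _ /and4P[_ _ sdD /sdP coverCD]]] := part C CP.
case/negP: sdD; apply/sdP => j.
by have := coverCD j; rewrite in_setU (negPf (missC j)).
Qed.

Lemma SC_unbalanced : 1 < s -> s < r -> SC K = 2.
Proof.
move=> s_gt1 lt_sr.
have sdP D := strong_dominating_unbalanced D (ltnW s_gt1) lt_sr.
apply: SC_eq => [P|]; first exact: leq_card_unbalanced.
pose j0 := Ordinal (ltnW s_gt1); pose j1 := Ordinal s_gt1.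
pose A : {set K} := [set inr j0].
have j1A : inr j1 \notin A by rewrite in_set1.
have j0A : inr j0 \in A by rewrite set11.
have [] := @strong_coalition_partition_setC K A; last by exists [set A; ~: A].
- by apply/set0Pn; exists (inr j0).
- by apply/set0Pn; exists (inr j1); rewrite in_setC.
- by apply/sdP => /(_ j1); apply/negP.
- by apply/sdP => /(_ j0); rewrite in_setC j0A.
Qed.

End CompleteBipartite.

Section Balanced.

Variable r : nat.
Notation K := (complete_bipartite r r).

Lemma deg_balanced (x : K) : deg x = r.
Proof. by case: x => k; rewrite ?deg_inl ?deg_inr. Qed.

Lemma strong_dominating_edge (x y : K) :
  edge x y -> strong_dominating [set x; y].
Proof.
move=> exy; apply/strong_dominatingP => z _.
have [exz | nexz] := boolP (edge z x).
  by exists x; rewrite ?set21 // exz !deg_balanced leqnn.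
exists y; rewrite ?set22 // !deg_balanced leqnn andbT.
by case: x y z exy nexz => [?|?] [?|?] [?|?].
Qed.

Lemma strong_dominating_set1F (x : K) : 1 < r -> ~~ strong_dominating [set x].
Proof.
move=> r_gt1.
(* Another vertex of the part of x is not adjacent to x. *)
have [z neq nadj] : exists2 z : K, z != x & ~~ edge z x.
  have other (k : 'I_r) : exists l : 'I_r, l != k.
    have [-> | neq] := eqVneq k (Ordinal r_gt1).
      by exists (Ordinal (ltnW r_gt1)).
    by exists (Ordinal r_gt1); rewrite eq_sym.
  by case: x => k; have [l neq] := other k; [exists (inl l) | exists (inr l)].
apply/strong_dominatingP => /(_ z); rewrite in_set1 => /(_ neq)[y].
by rewrite in_set1 => /eqP ->; rewrite (negPf nadj).
Qed.

Lemma SC_balanced : 0 < r -> SC K = 2 * r.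
Proof.
move=> r_gt0.
have cardK : #|K| = 2 * r by rewrite card_sum !card_ord mul2n addnn.
apply: SC_eq => [P|]; first by rewrite -cardK; apply: leq_card_strong_coalition_partition.
exists [set [set x] | x : K]; last by rewrite card_imset //; apply: set1_inj.
have [y exy] : exists y : K -> K, forall x, edge x (y x).
  by exists (fun x => match x with inl k => inr k | inr k => inl k end); case.
apply: strong_coalition_partition_set1 => x.
have neq : y x != x by apply: contraTneq (exy x) => ->; rewrite edge_irrefl.
case: (ltngtP r 1) => [|r_gt1|r1]; first by rewrite ltnNge r_gt0.
  right; split; first exact: strong_dominating_set1F.
  exists (y x) => //; rewrite /strong_coalition disjoints1 in_set1 eq_sym neq.
  by rewrite !strong_dominating_set1F // strong_dominating_edge.
left; apply/andP; split; last first.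
  by apply/existsP; exists x; rewrite eqxx deg_balanced cardK r1.
apply/strong_dominatingP => z; rewrite in_set1 => neqz; exists x.
  exact: set11.
rewrite !deg_balanced leqnn andbT.
have all_eq (k l : 'I_r) : k = l.
  by apply: val_inj; case: k l => [[|k] lk] [[|l] ll] //=; rewrite r1 in lk ll.
by case: x z neqz {neq} => k [] l //; rewrite (all_eq k l) eqxx.
Qed.

End Balanced.

Theorem proposition5p1 (r s : nat) (hr : 1 <= r) (hs : 1 <= s) :
  (r > s -> s > 1 -> SC (complete_bipartite r s) = 2) /\
  (r = s -> SC (complete_bipartite r s) = 2 * r).
Proof.
split=> [lt_sr s_gt1 | <-]; first exact: SC_unbalanced.
exact: SC_balanced.
Qed.
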